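(* Let $h\ge 0$ and let $(G,D)$ be a finite $3$-transposition group of type $4^{\bullet h}{:}(3^{\,\cdot}\,{}^{+}\Omega_6^{-}(3))$. Then the diagram of $(G,D)$ has size $n=126\cdot 4^{h}$ and spectrum $$((\,80\cdot 4^{h};\ [8\cdot 4^{h}]^{35},\ [-4^{h+1}]^{90},\ [0]^{\star}\,)).$$
   Context: A $3$-transposition group $(G,D)$ is a group $G$ generated by a conjugacy class $D$ of elements of order $2$ such that $|de|\in\{1,2,3\}$ for all $d,e\in D$. Its diagram is the graph with vertex set $D$ in which two elements are adjacent iff their product has order $3$; its size is $n=|D|$. The spectrum is that of the $(0,1)$-adjacency matrix, written $((k;\dots,[r]^c,\dots))$: first the degree $k$ of the (regular) diagram, counted once, then the remaining eigenvalues, $[r]^c$ meaning $r$ with multiplicity $c$; if listed values coincide, their multiplicities are added, and $[r]^\star$ means that $r$ has whatever further multiplicity (possibly zero) is required for the total multiplicity to be $n$. Let $V=\mathbb{F}_3^6$ carry a nondegenerate symmetric bilinear form of Witt index $2$ (sign $-$, equivalently discriminant $+1$). ${}^{+}\Omega_6^{-}(3)$ is the subgroup of its isometry group generated by the class of reflections with centers $\langle x\rangle$ such that the form takes the value $(x,x)=1$; these reflections are a class of $3$-transpositions. $3^{\,\cdot}\,{}^{+}\Omega_6^{-}(3)$ denotes a nonsplit extension $H$, by a central subgroup of order $3$, of this group, taken with a $3$-transposition class $E$ mapping onto the reflection class. $(G,D)$ has type $4^{\bullet h}{:}(3^{\,\cdot}\,{}^{+}\Omega_6^{-}(3))$ if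 $G$ has a normal $2$-subgroup $N$ with $|D\cap dN|=4^{h}$ for all $d\in D$ and $(G/N,DN/N)\cong(H,E)$. *)

(* Defs.v *)
From mathcomp Require Import all_boot all_order all_fingroup all_algebra.
From mathcomp Require Import all_solvable all_field sesquilinear.

Set Implicit Arguments.
Unset Strict Implicit.
Unset Printing Implicit Defensive.

Import GRing.Theory.

Local Open Scope ring_scope.
Local Open Scope group_scope.

Definition three_transposition_group (gT : finGroupType)
    (G : {group gT}) (D : {set gT}) : Prop :=
  [/\ D \in classes G,
      <<D>> = G,
      {in D, forall d, #[d] = 2%N} &
      {in D &, forall d e, #[d * e] \in [:: 1%N; 2%N; 3%N]}].

Definition diagram (gT : finGroupType) : rel gT := fun d e => #[d * e] == 3%N.

Definition adjacency_mx (T : finType) (A : {set T}) (e : rel T) :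
    'M[algC]_#|A| :=
  \matrix_(i, j) (e (enum_val i) (enum_val j))%:R%R.

Definition has_spectrum (n : nat) (A : 'M[algC]_n) (s : seq algC) : Prop :=
  (char_poly A = \prod_(r <- s) ('X - r%:P))%R.

(* The spectrum ((k; [r_1]^c_1, ..., [r]^star)), where cs lists the pairs
   (r_i, c_i).  The number m of further copies of r is determined by the rest,
   since char_poly of a matrix of size #|D| has degree #|D|. *)
Definition diagram_has_spectrum (gT : finGroupType) (D : {set gT})
    (k : nat) (cs : seq (algC * nat)) (r : algC) : Prop :=
  {in D, forall d, #|[set e in D | diagram d e]| = k} /\
  exists m : nat,
    has_spectrum (adjacency_mx D (@diagram gT))
      (k%:R%R :: flatten [seq nseq rc.2 rc.1 | rc <- cs] ++ nseq m r).

Local Notation V := 'rV['F_3]_6.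

Definition has_witt_index (f : {symmetric V}) (m : nat) : Prop :=
  (exists2 W : {vspace V}, (W <= orthov f W)%VS & \dim W = m) /\
  (forall W : {vspace V}, (W <= orthov f W)%VS -> (\dim W <= m)%N).

(* Matrices act on row vectors on the right, which matches the
   multiplication of {'GL_6['F_3]}. *)
Definition reflection_at (f : {symmetric V}) (x : V) (g : {'GL_6['F_3]}) : bool :=
  [forall v : V, v *m GLval g == v - (2%:R * f v x / f x x) *: x]%R.

Definition plus_reflections (f : {symmetric V}) : {set {'GL_6['F_3]}} :=
  [set g | [exists x : V, (f x x == 1%R) && reflection_at f x g]].

Definition plus_Omega (f : {symmetric V}) : {group {'GL_6['F_3]}} :=
  <<plus_reflections f>>%G.

(* (H, E) is 3 . +Omega_6^-(3); the form f is unique up to isometry. *)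
Definition nonsplit_3_plus_Omega6m3 (hT : finGroupType)
    (H : {group hT}) (E : {set hT}) : Prop :=
  three_transposition_group H E /\
  exists f : {symmetric V},
    [/\ nondegenerate f, has_witt_index f 2 &
     exists phi : {morphism H >-> {'GL_6['F_3]}},
       [/\ phi @* H = plus_Omega f,
           phi @* E = plus_reflections f,
           #|'ker phi| = 3%N,
           'ker phi \subset 'Z(H) &
           ~~ [splits H, over 'ker phi]]].

Definition type_4h_3_plus_Omega6m3 (h : nat) (gT : finGroupType)
    (G : {group gT}) (D : {set gT}) : Prop :=
  exists N : {group gT},
    [/\ N <| G, 2%N.-group N,
        {in D, forall d, #|D :&: d *: N| = (4 ^ h)%N} &
     exists (hT : finGroupType) (H : {group hT}) (E : {set hT}),
       nonsplit_3_plus_Omega6m3 H E /\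
       exists2 psi : {morphism G / N >-> hT},
         isom (G / N) H psi & psi @* (D / N) = E].

(* Main.v *)
Require Import Defs.
From mathcomp Require Import all_boot all_order all_fingroup all_algebra all_solvable all_field.
From mathcomp Require Import sesquilinear spectral ring.

(* The quotient by N identifies 4^h-element fibres of D with the reflections of
   the form, and the central kernel of order 3 changes neither the class nor its
   diagram.  So D is a 4^h-fold blow-up of the graph on the 126 lines spanned by
   vectors of norm 1, two lines being adjacent when they are distinct and not
   orthogonal.

   Degrees and common neighbours in this graph are obtained by Fourier analysis
   on V with a cubic character: a totally isotropic plane reduces the Gauss sum
   of the norm form to its orthogonal space modulo the plane, which is
   anisotropic, and gives -27; completing the square yields the Fourier
   transform of the unit sphere.  With q = 4^h, the adjacency matrix M then
   satisfies M^3 = 4 q M^2 + 32 q^2 M + 3840 q^2 J, with J the all-one matrix,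
   so its eigenvalues lie in {80 q, 8 q, -4 q, 0} and the traces of M, M^2 and J
   determine the multiplicities. *)

Set Implicit Arguments.
Unset Strict Implicit.
Unset Printing Implicit Defensive.

Import GRing.Theory Num.Theory.

Local Notation V := 'rV['F_3]_6.

Local Open Scope ring_scope.

(** * Spectra from traces *)

Lemma normal_spectral (n : nat) (A : 'M[algC]_n) :
  A \is normalmx ->
  exists d : 'rV[algC]_n, exists2 P : 'M_n, P \in unitmx &
    A = invmx P *m diag_mx d *m P.
Proof.
move=> /orthomx_spectralP A_eq; exists (spectral_diag A), (spectralmx A) => //.
exact: spectral_unit.
Qed.

Lemma char_poly_conj (n : nat) (P D : 'M[algC]_n) :
  P \in unitmx -> char_poly (invmx P *m D *m P) = char_poly D.
Proof.
move=> uP; rewrite /char_poly.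
have -> : char_poly_mx (invmx P *m D *m P) =
    map_mx polyC (invmx P) *m char_poly_mx D *m map_mx polyC P.
  rewrite /char_poly_mx !map_mxM mulmxBr mulmxBl; congr (_ - _).
  by rewrite mul_mx_scalar -scalemxAl -map_mxM mulVmx // map_mx1 scalemx1.
rewrite !det_mulmx mulrAC mulrC -det_mulmx -map_mxM mulVmx //.
by rewrite map_mx1 det1 mulr1.
Qed.

Lemma char_poly_diag (n : nat) (d : 'rV[algC]_n) :
  char_poly (diag_mx d) = \prod_i ('X - (d 0 i)%:P).
Proof.
rewrite char_poly_trig ?diag_mx_is_trig //.
by apply: eq_bigr => i _; rewrite mxE eqxx.
Qed.

(** Groups the eigenvalues by value, so that sums and products over them become weighted by
    multiplicities. *)
Lemma perm_eq_nseqs (T : eqType) (s l : seq T) :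
  uniq l -> {subset s <= l} ->
  perm_eq s (flatten [seq nseq (count_mem x s) x | x <- l]).
Proof.
move=> ul sl; apply/allP => x _ /=; apply/eqP.
rewrite count_flatten -map_comp sumnE big_map.
under eq_bigr => y _ do rewrite /= count_nseq /=.
have [xl|xl] := boolP (x \in l).
  rewrite (bigD1_seq x) //= eqxx mul1n big1 ?addn0 // => y /negPf yx.
  by rewrite yx mul0n.
rewrite (count_memPn _); last by apply: contra xl => /sl.
rewrite big1_seq // => y /= yl; case: eqP => // yx.
by rewrite yx (negPf xl) in yl.
Qed.

(** In an eigenbasis of [M], the diagonal entries of the conjugate of [J] satisfy two scalar
    identities: the cubic relation expresses each as a multiple of [x (x - 8q) (x + 4q)] at the
    eigenvalue [x], and [M J = 80q J] kills it unless [x = 80q]. *)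
Lemma spectrum_of_cubic_relation (n q : nat) (M J : 'M[algC]_n) :
  (0 < q)%N -> n = (126 * q)%N -> M \is hermsymmx ->
  M *m M *m M = (4 * q)%:R *: (M *m M) + (32 * q ^ 2)%:R *: M
                + (3840 * q ^ 2)%:R *: J ->
  M *m J = (80 * q)%:R *: J -> \tr J = n%:R ->
  \tr M = 0 -> \tr (M *m M) = (n * (80 * q))%:R ->
  exists m : nat, has_spectrum M
    ((80 * q)%:R :: flatten [seq nseq rc.2 rc.1 |
       rc <- [:: ((8 * q)%:R, 35%N); (- (4 * q)%:R, 90%N)]] ++ nseq m 0).
Proof.
move=> q_gt0 n_eq /hermitian_normalmx /normal_spectral[d [P uP M_eq]].
set Q : algC := q%:R.
have Q0 : Q != 0 by rewrite pnatr_eq0 -lt0n.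
have Pr A B : P *m (A *m B) *m invmx P =
    (P *m A *m invmx P) *m (P *m B *m invmx P).
  by rewrite !mulmxA mulmxKV.
have trP A : \tr (P *m A *m invmx P) = \tr A.
  by rewrite mxtrace_mulC mulmxA mulVmx // mul1mx.
have PM : P *m M *m invmx P = diag_mx d.
  by rewrite M_eq !mulmxA mulmxV // mul1mx mulmxK.
have PMM : P *m (M *m M) *m invmx P = diag_mx (\row_i (d 0 i * d 0 i)).
  by rewrite Pr PM mulmx_diag.
have PMMM : P *m (M *m M *m M) *m invmx P =
    diag_mx (\row_i (d 0 i * d 0 i * d 0 i)).
  rewrite Pr PM PMM mulmx_diag; congr diag_mx.
  by apply/rowP => i; rewrite !mxE.
(* [J'] is kept abstract; only its diagonal entries and their sum are used. *)
have [J' J'E] : exists J', J' = P *m J *m invmx P by exists (P *m J *m invmx P).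
have dE (e : 'rV[algC]_n) i : diag_mx e i i = e 0 i by rewrite mxE eqxx.
move=> cub MJ trJ trM trMM.
have cubE i : d 0 i ^+ 3 =
    4 * Q * d 0 i ^+ 2 + 32 * Q ^+ 2 * d 0 i + 3840 * Q ^+ 2 * J' i i.
  have /(congr1 (fun A : 'M_n => (P *m A *m invmx P) i i)) := cub.
  rewrite PMMM !mulmxDr !mulmxDl -!scalemxAr -!scalemxAl PMM PM -J'E dE !mxE.
  rewrite !eqxx !natrM /= -/Q !mulr1n => e.
  by rewrite !expr2 -e; ring.
have JE i : d 0 i * J' i i = 80 * Q * J' i i.
  have /(congr1 (fun A : 'M_n => (P *m A *m invmx P) i i)) := MJ.
  rewrite Pr PM -J'E -scalemxAr -scalemxAl -J'E mul_diag_mx !mxE.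
  by rewrite natrM.
have trJ' : \sum_i J' i i = 126 * Q.
  by rewrite -[LHS]/(\tr J') J'E trP trJ n_eq natrM.
have {}trM : \sum_i d 0 i = 0.
  rewrite -[RHS]trM -trP PM; apply: eq_bigr => i _; by rewrite dE.
have {}trMM : \sum_i d 0 i ^+ 2 = 126 * 80 * Q ^+ 2.
  have <- : \tr (M *m M) = 126 * 80 * Q ^+ 2 by rewrite trMM n_eq !natrM -/Q; ring.
  rewrite -trP PMM; apply: eq_bigr => i _; by rewrite dE mxE.
pose l := [:: 80 * Q; 8 * Q; - 4 * Q; 0].
have ul : uniq l.
  have H (a b : algC) : a - b != 0 -> a * Q != b * Q.
    by move=> ab; rewrite -subr_eq0 -mulrBl mulf_neq0.
  have H0 a : a != 0 -> a * Q != 0 by move=> a0; rewrite mulf_neq0.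
  rewrite /= !inE !negb_or !H ?H0 ?oppr_eq0 ?pnatr_eq0 //.
  - by rewrite opprK -natrD pnatr_eq0.
  - by rewrite opprK -natrD pnatr_eq0.
  - by rewrite -natrB // pnatr_eq0.
pose s := [seq d 0 i | i : 'I_n].
have sl : {subset s <= l}.
  move=> _ /mapP[i _ ->].
  (* The last three factors multiply to [3840 Q^2 J' i i], which the first one annihilates. *)
  have : (d 0 i - 80 * Q) * ((d 0 i - 8 * Q) * ((d 0 i + 4 * Q) * d 0 i)) = 0.
    have -> : (d 0 i - 80 * Q) * ((d 0 i - 8 * Q) * ((d 0 i + 4 * Q) * d 0 i)) =
      (d 0 i - 80 * Q) * (d 0 i ^+ 3 - (4 * Q * d 0 i ^+ 2 + 32 * Q ^+ 2 * d 0 i)).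
      by ring.
    rewrite cubE [X in _ * X](_ : _ = 3840 * Q ^+ 2 * J' i i); last by ring.
    by rewrite mulrCA mulrBl JE subrr mulr0.
  move/eqP; rewrite !mulf_eq0 !subr_eq0 addr_eq0 /l !inE.
  by rewrite mulNr.
have cnt (g : algC -> algC) :
    \sum_i g (d 0 i) = \sum_(x <- l) (count_mem x s)%:R * g x.
  transitivity (\sum_(x <- s) g x); first by rewrite big_map big_enum.
  rewrite (perm_big _ (perm_eq_nseqs ul sl)) big_flatten big_map /=.
  apply: eq_bigr => x _; rewrite big_nseq.
  by rewrite -Monoid.iteropE  mulr_natl.
have natQ_inj (c m : nat) x : x != 0 -> c%:R * x = m%:R * x :> algC -> c = m.
  by move=> x0 /(mulIf x0)/eqP; rewrite eqr_nat => /eqP.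
have Qn0 (c : algC) k : c != 0 -> c * Q ^+ k != 0.
  by move=> c0; rewrite mulf_neq0 ?expf_neq0.
(* Each multiplicity is isolated by summing over the eigenvalues a polynomial that vanishes at all
   the others: [x (x - 8Q) (x + 4Q)] here. For [8 Q] and [- 4 Q] a quadratic suffices, as the single
   eigenvalue [80 Q] can be subtracted. *)
have c80 : count_mem (80 * Q) s = 1%N.
  apply: (@natQ_inj _ _ (80 * 72 * 84 * Q ^+ 3)).
    by apply: Qn0; rewrite !mulf_eq0 !pnatr_eq0.
  have := cnt (fun x => x ^+ 3 - 4 * Q * x ^+ 2 - 32 * Q ^+ 2 * x).
  rewrite (eq_bigr (fun i => 3840 * Q ^+ 2 * J' i i)); last first.
    by move=> i _; rewrite cubE; ring.
  rewrite -mulr_sumr trJ' /l !big_cons big_nil => e.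
  transitivity (3840 * Q ^+ 2 * (126 * Q)); last by ring.
  by rewrite e; ring.
have c8 : count_mem (8 * Q) s = 35%N.
  apply: (@natQ_inj _ _ (8 * 12 * Q ^+ 2)).
    by apply: Qn0; rewrite !mulf_eq0 !pnatr_eq0.
  have := cnt (fun x => x ^+ 2 + 4 * Q * x).
  rewrite big_split /= -mulr_sumr trM trMM /l !big_cons big_nil c80 => e.
  transitivity (126 * 80 * Q ^+ 2 + 4 * Q * 0 - 80 * 84 * Q ^+ 2); last by ring.
  by rewrite e; ring.
have c4 : count_mem (- 4 * Q) s = 90%N.
  apply: (@natQ_inj _ _ (4 * 12 * Q ^+ 2)).
    by apply: Qn0; rewrite !mulf_eq0 !pnatr_eq0.
  have := cnt (fun x => x ^+ 2 - 8 * Q * x).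
  rewrite sumrB -mulr_sumr trM trMM /l !big_cons big_nil c80 => e.
  transitivity (126 * 80 * Q ^+ 2 - 8 * Q * 0 - 80 * 72 * Q ^+ 2); last by ring.
  by rewrite e; ring.
exists (count_mem 0 s).
rewrite /has_spectrum {1}M_eq char_poly_conj // char_poly_diag.
transitivity (\prod_(x <- s) ('X - x%:P)); first by rewrite big_map big_enum.
rewrite (perm_big _ (perm_eq_nseqs ul sl)) /l; apply: perm_big.
by rewrite /= !cats0 c80 c8 c4 !natrM -/Q mulNr.
Qed.

(** * Fourier transform of the unit sphere *)

Lemma F3_cases (a : 'F_3) : [\/ a = 0, a = 1 | a = -1].
Proof.
case: a => [[|[|[|//]]] Ha]; [constructor 1|constructor 2|constructor 3];
  exact/val_inj.
Qed.

Section CubicCharacter.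

Variables (w : algC) (w3 : 3.-primitive_root w).

(** The exponent is the representative 0, 1 or 2 of [a]. As [w] has order 3, this is a nontrivial
    additive character of the field. *)
Definition chi3 (a : 'F_3) : algC := w ^+ a.

Lemma chi3_0 : chi3 0 = 1. Proof. exact: expr0. Qed.

Lemma chi3_1 : chi3 1 = w. Proof. exact: expr1. Qed.

Lemma cubic_root_sum : 1 + w + w ^+ 2 = 0.
Proof.
have w1 : w != 1 by rewrite -(prim_order_dvd w3 1).
apply/eqP; move: w1; rewrite -subr_eq0 => /mulfI/inj_eq <-; apply/eqP.
rewrite [RHS]mulr0 [LHS](_ : _ = w ^+ 3 - 1); last by ring.
by rewrite (prim_expr_order w3) subrr.
Qed.

Lemma chi3_N1 : chi3 (-1) = - 1 - w.
Proof.
rewrite [LHS](_ : _ = w ^+ 2) //; apply/eqP; rewrite -subr_eq0; apply/eqP.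
by rewrite -cubic_root_sum; ring.
Qed.

Lemma chi3D a b : chi3 (a + b) = chi3 a * chi3 b.
Proof. by rewrite /chi3 -exprD /= (prim_expr_mod w3). Qed.

Lemma chi3_eq1 a : (chi3 a == 1) = (a == 0).
Proof. by rewrite /chi3 -(prim_order_dvd w3); case: (F3_cases a) => ->. Qed.

(** Orthogonality of the characters of ['F_3], here and in [eq0_chi3]: it turns conditions on values
    of the form into character sums. *)
Lemma neq0_chi3 a : (a != 0)%:R = (2 - chi3 a - chi3 (- a)) / 3.
Proof.
have three : (3 : algC) != 0 by rewrite pnatr_eq0.
case: (F3_cases a) => ->; rewrite ?oppr0 ?opprK ?chi3_0 ?chi3_1 ?chi3_N1 /=;
  by field.
Qed.

Lemma eq0_chi3 a : (a == 0)%:R = (1 + chi3 a + chi3 (- a)) / 3.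
Proof.
have three : (3 : algC) != 0 by rewrite pnatr_eq0.
case: (F3_cases a) => ->; rewrite ?oppr0 ?opprK ?chi3_0 ?chi3_1 ?chi3_N1 /=;
  by field.
Qed.

Variable (f : {symmetric V}).

Local Notation Q z := (f z z).

Lemma symformC x y : f x y = f y x.
Proof. by rewrite hermC expr0 mul1r. Qed.

(** If some [u] in [K] has [f z u != 0], translating the summation variable by [u] multiplies the
    sum by [chi3 (f z u)], which is not 1, so the sum is 0. *)
Lemma sum_chi3_orth (K : {vspace V}) z :
  \sum_(u in K) chi3 (f z u) = #|K|%:R * (z \in orthov f K)%:R.
Proof.
have [/mem_orthovP zK|/mem_orthovPn[u uK fzu]] := boolP (z \in _).
  rewrite mulr1 -sumr_const; apply: eq_bigr => u uK.
  by rewrite zK ?chi3_0.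
rewrite mulr0; set S := (X in X = 0).
have : (chi3 (f z u) - 1) * S = 0.
  rewrite mulrBl mul1r; apply/eqP; rewrite subr_eq0; apply/eqP.
  rewrite mulr_sumr [RHS](reindex_inj (addrI u)) /=.
  apply: eq_big => [v|v _]; first by rewrite rpredDl.
  by rewrite -chi3D linearDr.
by move/eqP; rewrite mulf_eq0 subr_eq0 chi3_eq1 (negPf fzu) => /eqP.
Qed.

Lemma card_vspaceF3 (K : {vspace V}) : #|K| = (3 ^ \dim K)%N.
Proof. by rewrite card_vspace card_Fp. Qed.

Hypothesis f_nondeg : nondegenerate f.

Lemma sum_chi3_all z : \sum_u chi3 (f z u) = 729 * (z == 0)%:R.
Proof.
rewrite -[X in X * _]/(729%N%:R).
have -> : 729%N = #|(fullv : {vspace V})| by rewrite card_vspaceF3 dimvf /dim /=.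
rewrite -memv0 -(eqP f_nondeg) -sum_chi3_orth.
by apply: eq_bigl => u; rewrite memvf.
Qed.

(** * Gauss sums of the norm form *)

Definition gauss_sum (t : 'F_3) : algC := \sum_z chi3 (t * Q z).

(* 2 = -1 in characteristic 3, whence the sign of the cross term. *)
Lemma symform_normD x y : Q (x + y) = Q x + Q y - f x y.
Proof.
rewrite linearDl !linearDr /= (symformC y x).
case: (F3_cases (f x y)) => ->; case: (F3_cases (Q x)) => ->;
  by case: (F3_cases (Q y)) => ->; apply/val_inj.
Qed.

(** Writing the second variable as [z + u] cancels [Q z]. What remains is linear in [z], so its sum
    over [z] vanishes unless [u = 0]. *)
Lemma gauss_sum_norm : gauss_sum 1 * gauss_sum (-1) = 729.
Proof.
rewrite /gauss_sum mulr_suml.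
transitivity (\sum_u chi3 (- Q u) * \sum_z chi3 (f u z)).
  under [RHS]eq_bigr => u _ do rewrite mulr_sumr.
  rewrite [RHS]exchange_big /=; apply: eq_bigr => z _.
  rewrite mulr_sumr (reindex_inj (addrI z)) /=; apply: eq_bigr => u _.
  rewrite -!chi3D symform_normD (symformC z u); congr chi3; ring.
under eq_bigr => u _ do rewrite sum_chi3_all.
rewrite (bigD1 0) //= big1 ?addr0 => [|u /negPf ->]; last by rewrite !mulr0.
by rewrite eqxx linear0l oppr0 chi3_0 mul1r mulr1.
Qed.

Hypothesis f_witt : has_witt_index f 2.

(** The sums reduce to the 81 vectors of [U], of which exactly the 9 in [W] are isotropic. The value
    of [gauss_sum_norm] then forces the other 72 to split evenly between the norms 1 and -1, giving
    [9 - 36]. *)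
Lemma gauss_sum_values : gauss_sum 1 = - 27 /\ gauss_sum (-1) = - 27.
Proof.
case: f_witt => -[W Wiso dimW] Wmax; pose U := orthov f W.
have cardW : #|W|%:R = 9 :> algC by rewrite card_vspaceF3 dimW.
have nz9 : (9 : algC) != 0 by rewrite pnatr_eq0.
have subWU u : u \in W -> u \in U by move/(subvP Wiso).
have fWU z u : z \in U -> u \in W -> f z u = 0 by move/mem_orthovP; apply.
(* Averaging over translations by [W]: for [u] in [W], [Q (z + u) = Q z - f z u], so the average
   over [u] keeps exactly the [z] orthogonal to [W]. *)
have gaussU (t : 'F_3) : t != 0 -> gauss_sum t = \sum_(z in U) chi3 (t * Q z).
  move=> t0; apply: (mulfI nz9).
  rewrite -[in LHS]cardW mulr_natl -sumr_const.
  transitivity (\sum_(u in W) \sum_z chi3 (t * Q z) * chi3 (f (- t *: z) u)).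
    apply: eq_bigr => u uW; rewrite /gauss_sum (reindex_inj (addIr u)) /=.
    apply: eq_bigr => z _; rewrite -chi3D symform_normD (fWU u u (subWU u uW) uW).
    by rewrite linearZl_LR /=; congr chi3; ring.
  rewrite exchange_big /= mulr_sumr [RHS]big_mkcond /=; apply: eq_bigr => z _.
  rewrite -mulr_sumr sum_chi3_orth cardW.
  have -> : (- t *: z \in orthov f W) = (z \in U).
    by rewrite rpredZeq oppr_eq0 (negPf t0).
  by case: (z \in U); rewrite ?mulr1 ?mulr0 1?mulrC.
(* An isotropic vector of [U] outside [W] would extend [W] to a totally isotropic space of dimension
   3, against the Witt index. *)
have Q0W z : z \in U -> Q z = 0 -> z \in W.
  move=> zU Qz; apply/negPn/negP => zW.
  have z0 : z != 0 by apply: contraNneq zW => ->; rewrite mem0v.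
  have iso : (W + <[z]> <= orthov f (W + <[z]>))%VS.
    rewrite orthovD !orthoDv Wiso orthov11 Qz eqxx andbT /=.
    by rewrite [X in _ && X]orthov_sym andbb -memvE.
  have := Wmax _ iso; rewrite dimv_disjoint_sum ?dimW ?dim_vline.
    by rewrite z0.
  apply/eqP; rewrite -subv0; apply/subvP => v /memv_capP[vW /vlineP[k v_eq]].
  move: vW; rewrite v_eq rpredZeq (negPf zW) orbF => /eqP ->.
  by rewrite scale0r mem0v.
pose N a : algC := #|[set z in U | Q z == a]|%:R.
have N0 : N 0 = 9.
  rewrite /N -cardW; congr (_%:R); apply: eq_card => z; rewrite inE.
  apply/andP/idP => [[zU /eqP] |zW]; first exact: Q0W.
  by rewrite subWU // fWU ?subWU.
have sumN (g : 'F_3 -> algC) :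
    \sum_(z in U) g (Q z) = N 0 * g 0 + N 1 * g 1 + N (-1) * g (-1).
  have partN a : \sum_(z in U) (Q z == a)%:R * g (Q z) = N a * g a.
    rewrite /N mulr_natl -sumr_const big_mkcond [RHS]big_mkcond /=.
    apply: eq_bigr => z _; rewrite inE; case: (z \in U) => //=.
    by case: eqP => [->|_]; rewrite ?mul1r ?mul0r.
  rewrite -!partN -!big_split /=; apply: eq_bigr => z _.
  by case: (F3_cases (Q z)) => ->; rewrite /= ?mul1r ?mul0r ?addr0 ?add0r.
(* Double sum of [chi3 (f u z)] over [u] in [W] and all [z]: summing over [z] first gives 729, over
   [u] first gives [9 * #|U|]. *)
have cardU : #|U|%:R = 81 :> algC.
  apply: (mulfI nz9).
  transitivity (\sum_(u in W) \sum_z chi3 (f u z)); last first.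
    under eq_bigr => u _ do rewrite sum_chi3_all.
    rewrite (bigD1 0) ?mem0v //= big1 ?addr0 => [|u /andP[_ /negPf ->]].
      by rewrite eqxx mulr1 -natrM.
    by rewrite mulr0.
  rewrite exchange_big /= -[in LHS]sumr_const mulr_sumr big_mkcond /=.
  apply: eq_bigr => z _; under eq_bigr => u _ do rewrite symformC.
  by rewrite sum_chi3_orth cardW -/U; case: (z \in U); rewrite ?mulr1 ?mulr0.
have N1N2 : N 1 + N (-1) = 72.
  have := sumN (fun=> 1); rewrite sumr_const cardU N0 !mulr1 -addrA => e.
  by apply: (addrI 9); rewrite -e -natrD.
have w2 : w ^+ 2 = - 1 - w.
  by apply/eqP; rewrite -subr_eq0; apply/eqP; rewrite -cubic_root_sum; ring.
have G1 : gauss_sum 1 = 9 + N 1 * w + N (-1) * (- 1 - w).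
  rewrite gaussU // (sumN (fun a => chi3 (1 * a))) !mul1r N0.
  by rewrite chi3_0 chi3_1 chi3_N1 mulr1.
have G2 : gauss_sum (-1) = 9 + N 1 * (- 1 - w) + N (-1) * w.
  rewrite gaussU // (sumN (fun a => chi3 (-1 * a))) !mulN1r N0 opprK oppr0.
  by rewrite chi3_0 chi3_1 chi3_N1 mulr1.
have N2E : N (-1) = 72 - N 1 by rewrite -N1N2 addrAC subrr add0r.
(* [gauss_sum_norm] reads N 1 * N (-1) = 36 ^ 2, while N 1 + N (-1) = 72. *)
have N1E : N 1 = 36.
  have := gauss_sum_norm; rewrite G1 G2 N2E => e.
  have : 3 * (N 1 - 36) ^+ 2 = 0.
    (* The last summand is a multiple of [w^2 + w + 1], hence zero; with it the equality becomes a
       polynomial identity in [w]. *)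
    transitivity ((9 + N 1 * w + (72 - N 1) * (-1 - w)) *
        (9 + N 1 * (-1 - w) + (72 - N 1) * w) - 729 +
        (w ^+ 2 - (- 1 - w)) * (2 * N 1 - 72) ^+ 2).
      by ring.
    by rewrite e w2 !subrr mul0r addr0.
  by move/eqP; rewrite mulf_eq0 pnatr_eq0 expf_eq0 subr_eq0 => /eqP.
by rewrite G1 G2 N2E N1E; split; ring.
Qed.

Definition sphere_sum (v : V) : algC := \sum_(z | Q z == 1) chi3 (f v z).

Lemma symform_normN x : Q (- x) = Q x.
Proof. by rewrite linearNl linearNr /= opprK. Qed.

(** The condition [Q z = 1] is expanded by [eq0_chi3]. Completing the square,
    [Q z + f v z = Q (z - v) - Q v] and [- Q z + f v z = - Q (z + v) + Q v], so both nontrivial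
    terms are translated Gauss sums. *)
Lemma sphere_sumE v :
  sphere_sum v = 243 * (v == 0)%:R - 9 * (chi3 (1 + Q v) + chi3 (- (1 + Q v))).
Proof.
have nz3 : (3 : algC) != 0 by rewrite pnatr_eq0.
have shift u : \sum_z chi3 (Q (z + u)) = - 27.
  rewrite -gauss_sum_values.1 /gauss_sum [RHS](reindex_inj (addIr u)).
  by apply: eq_bigr => z _; rewrite mul1r.
have shiftN u : \sum_z chi3 (- Q (z + u)) = - 27.
  rewrite -gauss_sum_values.2 /gauss_sum [RHS](reindex_inj (addIr u)).
  by apply: eq_bigr => z _; rewrite mulN1r.
have sumP : \sum_z chi3 (Q z - 1) * chi3 (f v z) = - 27 * chi3 (- (1 + Q v)).
  rewrite -(shift (- v)) mulr_suml; apply: eq_bigr => z _.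
  rewrite -!chi3D symform_normD symform_normN linearNr /= (symformC z v); congr chi3; ring.
have sumN : \sum_z chi3 (- (Q z - 1)) * chi3 (f v z) = - 27 * chi3 (1 + Q v).
  rewrite -(shiftN v) mulr_suml; apply: eq_bigr => z _.
  rewrite -!chi3D symform_normD (symformC z v); congr chi3; ring.
apply: (mulfI nz3); rewrite /sphere_sum big_mkcond mulr_sumr /=.
transitivity (\sum_z chi3 (f v z) + \sum_z chi3 (Q z - 1) * chi3 (f v z)
   + \sum_z chi3 (- (Q z - 1)) * chi3 (f v z)).
  rewrite -!big_split /=; apply: eq_bigr => z _.
  transitivity (3 * ((Q z == 1)%:R * chi3 (f v z))).
    by case: (Q z == 1); rewrite ?mul1r ?mul0r.
  by rewrite -subr_eq0 eq0_chi3; field.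
by rewrite sumP sumN sum_chi3_all; ring.
Qed.

Lemma sphere_sum0 : sphere_sum 0 = 252.
Proof. by rewrite sphere_sumE eqxx linear0l addr0 chi3_1 chi3_N1 mulr1; ring. Qed.

(** Here [1 + Q v] is nonzero, so the two characters in [sphere_sumE] add up to -1. *)
Lemma sphere_sum_neqN1 v : v != 0 -> Q v != -1 -> sphere_sum v = 9.
Proof.
move=> /negPf v0; rewrite sphere_sumE v0 mulr0.
case: (F3_cases (Q v)) => -> // _; first by rewrite addr0 chi3_1 chi3_N1; ring.
rewrite (_ : 1 + 1 = -1) ?opprK ?chi3_1 ?chi3_N1; last exact/val_inj.
by ring.
Qed.

Lemma sphere_sum_N1 v : v != 0 -> Q v = -1 -> sphere_sum v = - 18.
Proof.
move=> /negPf v0 Qv; rewrite sphere_sumE v0 mulr0 Qv subrr oppr0 chi3_0; ring.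
Qed.

(** * Degrees and common neighbours on the unit sphere *)

Lemma sphere_card : \sum_(z | Q z == 1) 1 = 252 :> algC.
Proof.
rewrite -sphere_sum0; apply: eq_bigr => z _.
by rewrite linear0l chi3_0.
Qed.

Lemma sphere_sumN v : sphere_sum (- v) = sphere_sum v.
Proof. by rewrite !sphere_sumE symform_normN oppr_eq0. Qed.

Lemma unit_vector_neq0 x : Q x = 1 -> x != 0.
Proof. by move=> Qx; apply: contra_eq_neq Qx => ->; rewrite linear0l. Qed.

Lemma sphere_degree x : Q x = 1 ->
  \sum_(z | Q z == 1) (f x z != 0)%:R = 162 :> algC.
Proof.
move=> Qx; have x0 := unit_vector_neq0 Qx.
have nz3 : (3 : algC) != 0 by rewrite pnatr_eq0.
transitivity ((2 * 252 + -1 * sphere_sum x + -1 * sphere_sum (- x)) / 3); last first.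
  by rewrite sphere_sumN sphere_sum_neqN1 ?Qx //; field.
rewrite -sphere_card !mulr_sumr -!big_split /= mulr_suml.
apply: eq_bigr => z _; rewrite neq0_chi3 linearNl /=; ring.
Qed.

(** Expanding both indicators by [neq0_chi3] gives nine sphere sums. Those at [x], [- x], [y] and
    [- y] equal 9, whence [(4 * 252 - 8 * 9) / 9 = 104]; those at opposite vectors agree. *)
Lemma sphere_codegree x y :
  Q x = 1 -> Q y = 1 ->
  \sum_(z | Q z == 1) (f x z != 0)%:R * (f y z != 0)%:R =
  104 + 2 / 9 * (sphere_sum (x + y) + sphere_sum (x - y)).
Proof.
move=> Qx Qy; have [x0 y0] := (unit_vector_neq0 Qx, unit_vector_neq0 Qy).
have nz9 : (9 : algC) != 0 by rewrite pnatr_eq0.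
have nz3 : (3 : algC) != 0 by rewrite pnatr_eq0.
have -> : 104 + 2 / 9 * (sphere_sum (x + y) + sphere_sum (x - y)) =
    (4 * 252 + -2 * sphere_sum x + -2 * sphere_sum (- x)
     + -2 * sphere_sum y + -2 * sphere_sum (- y) + 1 * sphere_sum (x + y)
     + 1 * sphere_sum (- (x + y))
     + 1 * sphere_sum (x - y) + 1 * sphere_sum (- (x - y))) / 9.
  rewrite !sphere_sumN (@sphere_sum_neqN1 x) ?(@sphere_sum_neqN1 y) ?Qx ?Qy //.
  by field.
rewrite -sphere_card !mulr_sumr -!big_split /= mulr_suml.
apply: eq_bigr => z _; rewrite !neq0_chi3 !linearNl !linearDl !linearNl /=.
by rewrite (opprD (f x z)) opprB !chi3D; field.
Qed.

Lemma sphere_codegree_eq x y : Q x = 1 -> (y == x) || (y == - x) ->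
  \sum_(z | Q z == 1) (f x z != 0)%:R * (f y z != 0)%:R = 162 :> algC.
Proof.
move=> Qx yx; rewrite -(sphere_degree Qx); apply: eq_bigr => z _.
suff -> : (f y z != 0) = (f x z != 0) by case: (_ != 0); rewrite ?mulr1 ?mulr0.
by case/orP: yx => /eqP->; rewrite ?linearNl ?oppr_eq0.
Qed.

(** Both [x + y] and [x - y] have norm [1 + 1 = -1], the exceptional value of the sphere sum. *)
Lemma sphere_codegree_orth x y : Q x = 1 -> Q y = 1 -> f x y = 0 ->
  \sum_(z | Q z == 1) (f x z != 0)%:R * (f y z != 0)%:R = 96 :> algC.
Proof.
move=> Qx Qy fxy.
have QE : Q (x + y) = -1 by rewrite symform_normD Qx Qy fxy; apply/val_inj.
have QE' : Q (x - y) = -1.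
  by rewrite symform_normD symform_normN linearNr /= Qx Qy fxy; apply/val_inj.
have nz (v : V) : Q v = -1 -> v != 0.
  by move=> Qv; apply: contra_eq_neq Qv => ->; rewrite linear0l.
rewrite sphere_codegree // !sphere_sum_N1 ?nz //.
have nz9 : (9 : algC) != 0 by rewrite pnatr_eq0.
by field.
Qed.

(** The norms of [x + y] and [x - y] are [-1 - f x y] and [-1 + f x y], both different from -1. *)
Lemma sphere_codegree_adj x y : Q x = 1 -> Q y = 1 -> f x y != 0 ->
  y != x -> y != - x ->
  \sum_(z | Q z == 1) (f x z != 0)%:R * (f y z != 0)%:R = 108 :> algC.
Proof.
move=> Qx Qy fxy yx yNx.
have QE : Q (x + y) != -1.
  by rewrite symform_normD Qx Qy; case: (F3_cases (f x y)) fxy => ->.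
have QE' : Q (x - y) != -1.
  rewrite symform_normD symform_normN linearNr /= Qx Qy.
  by case: (F3_cases (f x y)) fxy => ->.
have nz9 : (9 : algC) != 0 by rewrite pnatr_eq0.
have xDy : x + y != 0 by rewrite addr_eq0 eq_sym eqr_oppLR.
have xBy : x - y != 0 by rewrite subr_eq0 eq_sym.
by rewrite sphere_codegree // !sphere_sum_neqN1 //; field.
Qed.

End CubicCharacter.

(** * The graph of unit lines *)

Section ReflectionGraph.

Variables (f : {symmetric V}).
Hypotheses (f_nondeg : nondegenerate f) (f_witt : has_witt_index f 2).

(** The nonzero scalars are 1 and -1, so this is equality of spans; a reflection determines its
    center only up to sign. *)
Definition same_line (x y : V) : bool := (y == x) || (y == - x).

Lemma same_line_refl : reflexive same_line.
Proof. by move=> x; rewrite /same_line eqxx. Qed.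

Lemma same_line_sym : symmetric same_line.
Proof.
by move=> x y; rewrite /same_line [x == y]eq_sym [x == - y]eq_sym eqr_oppLR.
Qed.

Lemma same_line_nonorth x y z : same_line x y -> (f x z != 0) = (f y z != 0).
Proof. by case/orP => /eqP ->; rewrite ?linearNl ?oppr_eq0. Qed.

Lemma same_line_eq x y z : same_line x y -> same_line x z = same_line y z.
Proof.
by case/orP => /eqP ->; rewrite /same_line ?opprK // orbC.
Qed.

Variables (T : finType) (D : {set T}) (c : T -> V) (q : nat).
Hypothesis c_unit : {in D, forall d, f (c d) (c d) = 1}.
Hypothesis c_fibre : forall z, f z z = 1 -> #|[set d in D | same_line z (c d)]| = q.

(** A unit line contains two unit vectors, on which [F] agrees, and carries [q] elements of [D];
    hence the factor [q / 2]. *)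
Lemma sum_centers (F : V -> algC) : (forall z, F (- z) = F z) ->
  \sum_(d in D) F (c d) = q%:R / 2 * \sum_(z | f z z == 1) F z.
Proof.
move=> Feven; have nz2 : (2 : algC) != 0 by rewrite pnatr_eq0.
apply: (mulfI nz2); rewrite mulr_sumr.
transitivity (\sum_(d in D) \sum_(z | f z z == 1) (same_line z (c d))%:R * F z).
  apply: eq_bigr => d dD; have Qd := c_unit dD.
  (* The inner sum has two nonzero indicators, at [c d] and [- c d]. These vectors differ because
     [f (c d)] is 1 on one and -1 on the other. *)
  rewrite (bigD1 (c d)) ?Qd //= (bigD1 (- c d)) /=; last first.
    rewrite linearNl linearNr /= opprK Qd eqxx /=.
    apply/eqP => /(congr1 (fun v => f (c d) v)); rewrite linearNr /= Qd.
    by [].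
  rewrite big1 => [|z /andP[/andP[_ zd] zNd]]; last first.
    by rewrite same_line_sym /same_line (negPf zd) (negPf zNd) mul0r.
  rewrite same_line_refl {1}/same_line opprK eqxx orbT Feven addr0 /= !mul1r; ring.
rewrite exchange_big /= mulrA [2 * _]mulrC divfK // mulr_sumr.
apply: eq_bigr => z /eqP Qz; rewrite -mulr_suml; congr (_ * _).
rewrite -(c_fibre Qz) -sum1_card natr_sum big_mkcond [RHS]big_mkcond /=.
by apply: eq_bigr => d _; rewrite inE; case: (d \in D); case: same_line.
Qed.

Definition adjacent (d e : T) : bool := (f (c d) (c e) != 0) && ~~ same_line (c d) (c e).

Lemma centers_card : #|D| = (126 * q)%N.
Proof.
have [w w3] := C_prim_root_exists (isT : 0 < 3)%N.
apply/eqP; rewrite -(eqr_nat algC) -sumr_const (sum_centers (F := fun=> 1)) //.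
rewrite (sphere_card w3 f_nondeg f_witt) natrM; apply/eqP.
have nz2 : (2 : algC) != 0 by rewrite pnatr_eq0.
by field.
Qed.

Lemma nonorth_degree d : d \in D -> 
  \sum_(e in D) (f (c d) (c e) != 0)%:R = (81 * q)%:R :> algC.
Proof.
move=> dD; have [w w3] := C_prim_root_exists (isT : 0 < 3)%N.
rewrite (sum_centers (F := fun z => (f (c d) z != 0)%:R)); last first.
  by move=> z; rewrite linearNr oppr_eq0.
have nz2 : (2 : algC) != 0 by rewrite pnatr_eq0.
by rewrite (sphere_degree w3 f_nondeg f_witt) ?c_unit // natrM; field.
Qed.

Lemma fibre_degree d : d \in D ->
  \sum_(e in D) (same_line (c d) (c e))%:R = q%:R :> algC.
Proof.
move=> dD; rewrite -(c_fibre (c_unit dD)) -sum1_card natr_sum big_mkcond [RHS]big_mkcond /=.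
by apply: eq_bigr => e _; rewrite inE; case: (e \in D); case: same_line.
Qed.

(** A unit vector is not orthogonal to itself, so pairs on one line are among the nonorthogonal ones
    and can be subtracted. *)
Lemma adjacentE d e : d \in D -> (adjacent d e)%:R =
  (f (c d) (c e) != 0)%:R - (same_line (c d) (c e))%:R :> algC.
Proof.
move=> dD; rewrite /adjacent; have [de|de] := boolP (same_line _ _); last first.
  by rewrite andbT subr0.
rewrite andbF symformC -(same_line_nonorth _ de) c_unit //= subrr //.
Qed.

Lemma adjacent_degree d : d \in D -> #|[set e in D | adjacent d e]| = (80 * q)%N.
Proof.
move=> dD; apply/eqP; rewrite -(eqr_nat algC).
transitivity (\sum_(e in D) (adjacent d e)%:R == (80 * q)%:R :> algC).
  congr (_ == _); rewrite -sum1_card natr_sum big_mkcond [RHS]big_mkcond /=.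
  by apply: eq_bigr => e _; rewrite inE; case: (e \in D); case: adjacent.
under eq_bigr => e _ do rewrite adjacentE //.
by rewrite sumrB nonorth_degree // fibre_degree // !natrM; apply/eqP; ring.
Qed.

Local Notation n := #|D|.
(** [B] keeps the pairs on a common line, since sphere sums count nonorthogonality directly; [C] is
    the block matrix of the fibres, and the adjacency matrix is [B - C]. *)
Let J : 'M[algC]_n := const_mx 1.
Let B : 'M[algC]_n := \matrix_(i, j) (f (c (enum_val i)) (c (enum_val j)) != 0)%:R.
Let C : 'M[algC]_n := \matrix_(i, j) (same_line (c (enum_val i)) (c (enum_val j)))%:R.
Let M := adjacency_mx D adjacent.

Let Q : algC := q%:R.

Lemma adjacency_mxE : M = B - C.
Proof. by apply/matrixP => i j; rewrite !mxE adjacentE ?enum_valP. Qed.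

Lemma sum_ord_D (F : T -> algC) : \sum_(i < n) F (enum_val i) = \sum_(d in D) F d.
Proof. by rewrite [RHS]big_enum_val. Qed.

(** Rows of [B] indexed by one fibre coincide, and a fibre has [q] elements. *)
Lemma fibre_mul_nonorth : C *m B = Q *: B.
Proof.
apply/matrixP => i j; rewrite !mxE.
transitivity (\sum_(k < n) (same_line (c (enum_val i)) (c (enum_val k)))%:R *
   (f (c (enum_val i)) (c (enum_val j)) != 0)%:R : algC).
  apply: eq_bigr => k _; rewrite !mxE.
  have [ik|_] := boolP (same_line _ _); last by rewrite !mul0r.
  by rewrite (same_line_nonorth _ ik).
rewrite -mulr_suml (sum_ord_D (fun e => (same_line _ (c e))%:R)).
by rewrite fibre_degree ?enum_valP.
Qed.

Lemma fibre_mx_sqr : C *m C = Q *: C.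
Proof.
apply/matrixP => i j; rewrite !mxE.
transitivity (\sum_(k < n) (same_line (c (enum_val i)) (c (enum_val k)))%:R *
   (same_line (c (enum_val i)) (c (enum_val j)))%:R : algC).
  apply: eq_bigr => k _; rewrite !mxE.
  have [ik|_] := boolP (same_line (c (enum_val i)) (c (enum_val k)));
    last by rewrite !mul0r.
  by rewrite (same_line_eq _ ik).
rewrite -mulr_suml (sum_ord_D (fun e => (same_line _ (c e))%:R)).
by rewrite fibre_degree ?enum_valP.
Qed.

Lemma nonorth_mx_tr : B^T = B.
Proof. by apply/matrixP => i j; rewrite !mxE symformC. Qed.

Lemma fibre_mx_tr : C^T = C.
Proof. by apply/matrixP => i j; rewrite !mxE same_line_sym. Qed.

Lemma nonorth_mul_fibre : B *m C = Q *: B.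
Proof.
by rewrite -nonorth_mx_tr -fibre_mx_tr -trmx_mul fibre_mul_nonorth linearZ.
Qed.

Lemma nonorth_mx_all : B *m J = (81 * Q) *: J.
Proof.
apply/matrixP => i j; rewrite !mxE.
transitivity (\sum_(k < n) (f (c (enum_val i)) (c (enum_val k)) != 0)%:R : algC).
  by apply: eq_bigr => k _; rewrite !mxE mulr1.
rewrite (sum_ord_D (fun e => (f _ (c e) != 0)%:R)) nonorth_degree ?enum_valP //.
by rewrite natrM mulr1.
Qed.

Lemma fibre_mx_all : C *m J = Q *: J.
Proof.
apply/matrixP => i j; rewrite !mxE.
transitivity (\sum_(k < n) (same_line (c (enum_val i)) (c (enum_val k)))%:R : algC).
  by apply: eq_bigr => k _; rewrite !mxE mulr1.
rewrite (sum_ord_D (fun e => (same_line _ (c e))%:R)) fibre_degree ?enum_valP //.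
by rewrite mulr1.
Qed.

(** The codegrees 96, 108 and 162 times [q / 2] are [48 q] for orthogonal lines, [(48 + 6) q] for
    adjacent ones and [(48 + 6 + 27) q] on a common line. *)
Lemma nonorth_mx_sqr : B *m B = Q *: (48 *: J + 6 *: B + 27 *: C).
Proof.
have [w w3] := C_prim_root_exists (isT : 0 < 3)%N.
have nz2 : (2 : algC) != 0 by rewrite pnatr_eq0.
apply/matrixP => i j; rewrite !mxE.
set x := c (enum_val i); set y := c (enum_val j).
have [Qx Qy] : f x x = 1 /\ f y y = 1 by rewrite !c_unit ?enum_valP.
transitivity (\sum_(k < n) (f x (c (enum_val k)) != 0)%:R *
   (f y (c (enum_val k)) != 0)%:R : algC).
  by apply: eq_bigr => k _; rewrite !mxE (symformC _ y).
rewrite (sum_ord_D (fun e => (f x (c e) != 0)%:R * (f y (c e) != 0)%:R)).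
rewrite (sum_centers (F := fun z => (f x z != 0)%:R * (f y z != 0)%:R)); last first.
  by move=> z; rewrite !linearNr /= !oppr_eq0.
have [xy|] := boolP (same_line x y).
  rewrite (sphere_codegree_eq w3) // symformC -(same_line_nonorth _ xy) Qx /=.
  by rewrite /Q; field.
rewrite negb_or => /andP[yx yNx]; have [fxy|fxy] := eqVneq (f x y) 0.
  by rewrite (sphere_codegree_orth w3) //= /Q; field.
by rewrite (sphere_codegree_adj w3) //= /Q; field.
Qed.

Lemma adjacency_mx_sqr : M *m M = Q *: (48 *: J + 4 *: M + 32 *: C).
Proof.
rewrite adjacency_mxE mulmxBl !mulmxBr nonorth_mx_sqr fibre_mul_nonorth.
rewrite nonorth_mul_fibre fibre_mx_sqr.
by apply/matrixP => i j; rewrite !mxE; ring.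
Qed.

Lemma adjacency_mx_all : M *m J = (80 * Q) *: J.
Proof.
rewrite adjacency_mxE mulmxBl nonorth_mx_all fibre_mx_all -scalerBl; congr (_ *: _); ring.
Qed.

Lemma adjacency_mx_tr : M^T = M.
Proof. by rewrite adjacency_mxE linearB /= nonorth_mx_tr fibre_mx_tr. Qed.

Lemma adjacency_mx_diag i : M i i = 0.
Proof. by rewrite !mxE /adjacent same_line_refl andbF. Qed.

Lemma reflection_graph_spectrum : (0 < q)%N ->
  exists m : nat, has_spectrum M
    ((80 * q)%:R :: flatten [seq nseq rc.2 rc.1 |
       rc <- [:: ((8 * q)%:R, 35%N); (- (4 * q)%:R, 90%N)]] ++ nseq m 0).
Proof.
move=> q_gt0; apply: (@spectrum_of_cubic_relation _ _ _ J) => //.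
- exact: centers_card.
- apply: realsym_hermsym.
    by apply/is_hermitianmxP; rewrite expr0 scale1r map_mx_id ?adjacency_mx_tr.
  by apply/mxOverP => i j; rewrite mxE realn.
(* The cubic relation is the quadratic one multiplied by [M] on the right, where [J] and [C] are
   absorbed; [3840 = 48 * 80]. *)
- have JM : J *m M = (80 * Q) *: J.
    have JT : J^T = J by apply/matrixP => i j; rewrite !mxE.
    by rewrite -JT -adjacency_mx_tr -trmx_mul adjacency_mx_all linearZ /= JT.
  have CM : C *m M = Q *: M.
    by rewrite adjacency_mxE mulmxBr fibre_mul_nonorth fibre_mx_sqr scalerBr.
  rewrite {1}adjacency_mx_sqr -scalemxAl !mulmxDl -!scalemxAl JM CM.
  by apply/matrixP => i j; rewrite !natrM [in LHS]mxE !mxE -/Q; ring.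
- by rewrite adjacency_mx_all natrM.
- by rewrite /mxtrace; under eq_bigr => i _ do rewrite mxE; rewrite sumr_const card_ord.
- by rewrite /mxtrace big1 // => i _; exact: adjacency_mx_diag.
(* Each diagonal entry of the square is [q (48 + 0 + 32) = 80 q]. *)
rewrite /mxtrace adjacency_mx_sqr.
transitivity (\sum_(i < n) 80 * Q); last first.
  by rewrite sumr_const card_ord [RHS]natrM [RHS]mulr_natl natrM.
apply: eq_bigr => i _; rewrite 6!mxE adjacency_mx_diag !mxE same_line_refl.
rewrite /= !mulr1; ring.
Qed.

End ReflectionGraph.

(** * Reflections *)

Section UnitReflections.

Variable (f : {symmetric V}).

(** In characteristic 3 the coefficient [-2 / f x x] is 1 for a unit center. *)
Lemma reflection_atP x (g : {'GL_6['F_3]}) : f x x = 1 ->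
  reflect (forall v, v *m GLval g = v + f v x *: x) (reflection_at f x g).
Proof.
move=> Qx.
have E (v : V) : v - (2%:R * f v x / f x x) *: x = v + f v x *: x.
  rewrite Qx divr1 -scaleNr; congr (_ + _ *: _).
  by case: (F3_cases (f v x)) => ->; apply/val_inj.
by apply: (iffP forallP) => gE v; [rewrite -E (eqP (gE v)) | rewrite E gE].
Qed.

Lemma GLval_rV_inj (g k : {'GL_6['F_3]}) :
  (forall v : V, v *m GLval g = v *m GLval k) -> g = k.
Proof.
by move=> gk; apply/val_inj/row_matrixP => i /=; rewrite !rowE; apply: gk.
Qed.

Lemma reflection_exists x : f x x = 1 ->
  exists2 g : {'GL_6['F_3]}, g \in plus_reflections f & reflection_at f x g.
Proof.
(* [a] is the column of the linear form [f _ x], so [a *m x] is the rank one map sending [v] to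
   [f v x *: x]. *)
move=> Qx; pose a : 'cV['F_3]_6 := \col_i f (delta_mx 0 i) x.
pose R : 'M_6 := 1%:M + a *m x.
have RE v : v *m R = v + f v x *: x.
  rewrite mulmxDr mulmx1 mulmxA; congr (_ + _).
  rewrite [v *m a]mx11_scalar mul_scalar_mx; congr (_ *: _).
  rewrite mxE [in RHS](row_sum_delta v) linear_sumlz.
  by apply: eq_bigr => i _; rewrite !mxE linearZl_LR.
have RR : R *m R = 1%:M.
  apply/row_matrixP => i; rewrite !rowE mulmxA mulmx1 !RE.
  rewrite linearDl linearZl_LR /= Qx -addrA -scalerDl.
  set b := f _ x; rewrite (_ : b + (b + b * 1) = 0) ?scale0r ?addr0 //.
  by case: (F3_cases b) => ->; apply/val_inj.
have uR : R \in unitmx by case: (mulmx1_unit RR).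
have gR : reflection_at f x (Sub R uR : {'GL_6['F_3]}).
  by apply/(reflection_atP _ Qx) => v; rewrite SubK RE.
exists (Sub R uR : {'GL_6['F_3]}) => //.
by rewrite inE; apply/existsP; exists x; rewrite Qx eqxx.
Qed.

Lemma reflections_eq x y (g k : {'GL_6['F_3]}) : f x x = 1 -> f y y = 1 ->
  reflection_at f x g -> reflection_at f y k -> (g == k) = same_line x y.
Proof.
move=> Qx Qy /(reflection_atP _ Qx) gE /(reflection_atP _ Qy) kE.
apply/eqP/orP => [gk|xy].
  (* Evaluating the common reflection at [x] gives [f x y *: y = x]. *)
  have := gE x; rewrite gk kE Qx scale1r => /addrI.
  have x0 := unit_vector_neq0 Qx.
  case: (F3_cases (f x y)) => ->.
  - by rewrite scale0r => x0'; rewrite -x0' eqxx in x0.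
  - by rewrite scale1r => ->; left.
  - by rewrite scaleN1r => <-; right; rewrite opprK.
apply: GLval_rV_inj => v; rewrite gE kE.
by case: xy => /eqP ->; rewrite ?linearNr ?scaleNr ?scalerN ?opprK.
Qed.

(** The two products differ at [v] by [f x y] times [f v x *: y - f v y *: x]. At [v = x] this
    vanishes only if [f x y = 0] or [y = f x y *: x]. *)
Lemma reflections_commute x y (g k : {'GL_6['F_3]}) : f x x = 1 -> f y y = 1 ->
  reflection_at f x g -> reflection_at f y k ->
  (g * k == k * g)%g = (f x y == 0) || same_line x y.
Proof.
move=> Qx Qy gx ky; rewrite -(reflections_eq Qx Qy gx ky).
have gE := reflection_atP _ Qx gx; have kE := reflection_atP _ Qy ky.
have gkE v : v *m GLval (g * k)%g =
    v + f v x *: x + f v y *: y + (f v x * f x y) *: y.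
  rewrite GL_MxE mulmxA gE kE linearDl linearZl_LR /= scalerDl.
  by rewrite !addrA.
have kgE v : v *m GLval (k * g)%g =
    v + f v x *: x + f v y *: y + (f v y * f x y) *: x.
  rewrite GL_MxE mulmxA kE gE linearDl linearZl_LR /= scalerDl (symformC f y x).
  by rewrite addrA; congr (_ + _); rewrite addrAC.
apply/eqP/orP => [gk|[/eqP fxy|/eqP->]] //; last first.
  by apply: GLval_rV_inj => v; rewrite gkE kgE fxy !mulr0 !scale0r.
have [fxy|fxy] := eqVneq (f x y) 0; [by left | right].
have := gkE x; rewrite gk kgE Qx => /addrI.
rewrite mul1r (reflections_eq Qx Qy gx ky) -scalerA => /(scalerI fxy) <-.
rewrite /same_line; case: (F3_cases (f x y)) fxy => -> // _.
  by rewrite scale1r eqxx.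
by rewrite scaleN1r eqxx orbT.
Qed.

End UnitReflections.

Local Close Scope ring_scope.
Local Open Scope group_scope.

(** * The diagram modulo N and the central kernel *)

Lemma involution_inv (gT : finGroupType) (x : gT) : #[x] = 2 -> x^-1 = x.
Proof. by move=> x2; apply/eqP; rewrite eq_invg_mul -(expg_order x) x2. Qed.

(** The quotient [k] of [x] by [y] is central, so [x^2 = k^2 y^2] gives [k^2 = 1], and [k] lies in a
    group of odd order. *)
Lemma central_extension_inj_involutions (hT rT : finGroupType) (H : {group hT})
    (phi : {morphism H >-> rT}) (x y : hT) :
  'ker phi \subset 'Z(H) -> odd #|'ker phi| ->
  x \in H -> y \in H -> x ^+ 2 = 1 -> y ^+ 2 = 1 -> phi x = phi y -> x = y.
Proof.
move=> kerZ kerO xH yH x2 y2 xy.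
have kK : x * y^-1 \in 'ker phi.
  by apply/kerP; rewrite ?groupM ?groupV // morphM ?morphV ?groupV //= xy mulgV.
have /centerP[_ kC] := subsetP kerZ _ kK.
have kE : x = x * y^-1 * y by rewrite mulgKV.
have k2 : (x * y^-1) ^+ 2 = 1.
  by move: x2; rewrite {1}kE expgMn ?y2 ?mulg1 //; apply: kC.
suff /eqP : x * y^-1 = 1 by rewrite -eq_mulgV1 => /eqP.
apply/eqP; rewrite -order_eq1 -dvdn1.
have : #[x * y^-1] %| gcdn 2 #|'ker phi|.
  by rewrite dvdn_gcd order_dvdn k2 eqxx order_dvdG.
by rewrite (eqP (_ : coprime 2 _)) // coprime2n.
Qed.

Lemma order_mul_involutions (gT : finGroupType) (d e : gT) :
  #[d] = 2 -> #[e] = 2 -> #[d * e] \in [:: 1%N; 2%N; 3%N] ->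
  (#[d * e] == 3) = (d * e != e * d).
Proof.
move=> d2 e2 de123.
have -> : (d * e == e * d) = (#[d * e] %| 2).
  by rewrite order_dvdn expgS expg1 -eq_invg_mul invMg !involution_inv // eq_sym.
by move: de123; rewrite !inE => /or3P[] /eqP ->.
Qed.

Section Extension.

Variables (gT hT : finGroupType) (G N : {group gT}) (D : {set gT}).
Variables (H : {group hT}) (E : {set hT}) (f : {symmetric V}%R).
Variables (phi : {morphism H >-> {'GL_6['F_3]}}) (psi : {morphism G / N >-> hT}).
Hypotheses (GD : three_transposition_group G D) (HE : three_transposition_group H E).
Hypotheses (nNG : N <| G) (N2 : 2.-group N).
Hypotheses (phiE : phi @* E = plus_reflections f) (phi3 : #|'ker phi| = 3).
Hypotheses (phiZ : 'ker phi \subset 'Z(H)).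
Hypotheses (psiH : isom (G / N) H psi) (psiE : psi @* (D / N) = E).

Let rho d := phi (psi (coset N d)).

Let DG : D \subset G. Proof. by case: GD => _ <- _ _; apply: subset_gen. Qed.
Let EH : E \subset H. Proof. by case: HE => _ <- _ _; apply: subset_gen. Qed.
Let GN : G \subset 'N(N). Proof. exact: normal_norm. Qed.
Let DinG d : d \in D -> d \in G. Proof. exact: (subsetP DG). Qed.

Let psi_in x : x \in G -> psi (coset N x) \in H.
Proof.
by move=> xG; case/isomP: psiH => _ <-; apply: mem_morphim; rewrite mem_quotient.
Qed.

Let psi_E d : d \in D -> psi (coset N d) \in E.
Proof.
move=> dD; rewrite -psiE; apply: mem_morphim; first by rewrite mem_quotient ?DinG.
by apply: mem_morphim => //; rewrite (subsetP GN) ?DinG.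
Qed.

Let rhoM x y : x \in G -> y \in G -> rho (x * y) = rho x * rho y.
Proof.
move=> xG yG; have nN := subsetP GN.
rewrite /rho (morphM (coset_morphism N)) ?nN //.
by rewrite morphM ?mem_quotient // morphM ?psi_in.
Qed.

Lemma rho_reflection d : d \in D -> rho d \in plus_reflections f.
Proof.
by move=> dD; rewrite -phiE mem_morphim ?psi_E // (subsetP EH) ?psi_E.
Qed.

Lemma rho_onto g : g \in plus_reflections f -> exists2 d, d \in D & rho d = g.
Proof.
rewrite -phiE => /morphimP[x _ xE ->].
move: xE; rewrite -psiE => /morphimP[y _ yD ->].
by case/morphimP: yD => d _ dD ->; exists d.
Qed.

(** Equal reflections lift to equal elements of [E], because the kernel is central of order 3, and
    [psi] is injective on [G / N]. *)
Lemma rho_eq d e : d \in D -> e \in D -> (rho d == rho e) = (e \in d *: N).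
Proof.
move=> dD eD; have [dG eG] := (DinG dD, DinG eD).
rewrite mem_lcoset; apply/eqP/idP => [de|deN].
  have : psi (coset N d) = psi (coset N e).
    apply: (central_extension_inj_involutions phiZ) de; rewrite ?phi3 ?psi_in //.
      by case: HE => _ _ /(_ _ (psi_E dD)) + _ => <-; rewrite expg_order.
    by case: HE => _ _ /(_ _ (psi_E eD)) + _ => <-; rewrite expg_order.
  case/isomP: psiH => /injmP psi_inj _ /psi_inj.
  rewrite !mem_quotient // => /(_ isT isT).
  move=> ce; have [dN eN] := (subsetP GN _ dG, subsetP GN _ eG).
  by apply: coset_idr; rewrite ?groupM ?groupV // morphM ?morphV ?groupV //= ce mulVg.
have -> : e = d * (d^-1 * e) by rewrite mulKVg.
rewrite /rho (morphM (coset_morphism N)) ?(subsetP GN) ?groupM ?groupV //=.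
by rewrite (coset_id deN) mulg1.
Qed.

(** Noncommutation could only be lost in the image. If [d * e] has order 3 and the images commute,
    then [rho (d * e)] has order dividing 2 and 3, so [rho d = rho e] and [d * e] lies in the
    2-group [N], a contradiction. *)
Lemma diagram_rho d e : d \in D -> e \in D ->
  diagram d e = (rho d * rho e != rho e * rho d).
Proof.
move=> dD eD; have [dG eG] := (DinG dD, DinG eD).
have [_ _ D2 D3] := GD.
rewrite /diagram (order_mul_involutions (D2 _ dD) (D2 _ eD) (D3 _ _ dD eD)).
apply/idP/idP; last by apply: contra => /eqP de; rewrite -!rhoM // de.
move=> de; apply/eqP => rho_de.
have de3 : #[d * e] = 3.
  by apply/eqP; rewrite (order_mul_involutions (D2 _ dD) (D2 _ eD) (D3 _ _ dD eD)).
have rho1 : rho 1 = 1 by rewrite /rho !morph1.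
have r3 : rho (d * e) ^+ 3 = 1.
  rewrite !expgSr expg0 !mul1g -!rhoM ?groupM // -rho1; congr rho.
  by rewrite -(expg_order (d * e)) de3 !expgSr expg0 !mul1g.
have rr x : x \in D -> rho x * rho x = 1.
  move=> xD; rewrite -rhoM ?DinG // -rho1; congr rho.
  by rewrite -(expg_order x) D2.
have r2 : rho (d * e) ^+ 2 = 1.
  rewrite rhoM // expgS expg1 -mulgA [X in _ * X]mulgA -rho_de.
  by rewrite !mulgA rr // mul1g rr.
have r1 : rho (d * e) = 1 by move: r3; rewrite expgSr r2 mul1g.
have : rho d == rho e by apply/eqP/(mulIg (rho e)); rewrite -rhoM // r1 rr.
rewrite rho_eq // mem_lcoset involution_inv ?D2 // => /(mem_p_elt N2).
by rewrite /p_elt de3.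
Qed.

End Extension.

Local Close Scope group_scope.

(** * Centers of reflections, and the diagram as a blow-up of the graph of unit lines *)

(** One of the two opposite unit centers, chosen arbitrarily; the default 0 occurs only outside
    [plus_reflections f]. *)
Definition reflection_center (f : {symmetric V}%R) (g : {'GL_6['F_3]}) : V :=
  odflt 0%R [pick x : V | (f x x == 1%R) && reflection_at f x g].

Lemma reflection_centerP (f : {symmetric V}%R) g : g \in plus_reflections f ->
  f (reflection_center f g) (reflection_center f g) = 1%R
  /\ reflection_at f (reflection_center f g) g.
Proof.
rewrite inE /reflection_center => /existsP[x gx].
by case: pickP => [y /andP[/eqP -> ->]|/(_ x)]; last by rewrite gx.
Qed.

Theorem proposition6p20 (h : nat) (gT : finGroupType)
    (G : {group gT}) (D : {set gT}) :
  three_transposition_group G D ->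
  type_4h_3_plus_Omega6m3 h G D ->
  #|D| = (126 * 4 ^ h)%N /\
  diagram_has_spectrum D (80 * 4 ^ h)
    [:: ((8 * 4 ^ h)%:R, 35%N); (- (4 ^ (h + 1))%:R, 90%N)]%R 0%R.
Proof.
move=> GD [N [nNG N2 fibre [hT [H [E [[HE [f [f_nd f_witt]]]]]]]]].
move=> [phi [_ phiE phi3 phiZ _]] [psi psiH psiE].
pose rho d := phi (psi (coset N d)).
pose c d := reflection_center f (rho d).
have rhoR d : d \in D -> rho d \in plus_reflections f.
  exact: (rho_reflection GD HE nNG phiE psiE).
have cP d (dD : d \in D) := reflection_centerP (rhoR d dD).
have c_unit : {in D, forall d, f (c d) (c d) = 1%R} by move=> d /cP[].
(* For a lift [d] of the reflection at [z], the elements with center on the line of [z] are those of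
   [D] in [d *: N]. *)
have c_fibre z : f z z = 1%R -> #|[set d in D | same_line z (c d)]| = 4 ^ h.
  move=> Qz; have [g gR gz] := reflection_exists Qz.
  have [d dD rd] : exists2 d, d \in D & rho d = g := rho_onto phiE psiE gR.
  rewrite -(fibre d dD); apply: eq_card => e; rewrite !inE.
  have [eD|//] := boolP (e \in D); have [Qe re] := cP e eD.
  rewrite -(rho_eq GD HE nNG phi3 phiZ psiH psiE dD eD) -/(rho d) -/(rho e) rd.
  by rewrite (reflections_eq Qz Qe gz re).
have diaE : {in D &, forall d e, diagram d e = adjacent f c d e}.
  move=> d e dD eD; have [[Qd rd] [Qe re]] := (cP d dD, cP e eD).
  rewrite (diagram_rho GD HE nNG N2 phi3 phiZ psiH psiE dD eD) -/(rho d) -/(rho e).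
  by rewrite (reflections_commute Qd Qe rd re) negb_or.
split; first exact: (centers_card f_nd f_witt c_unit c_fibre).
split.
  move=> d dD; rewrite -(adjacent_degree f_nd f_witt c_unit c_fibre dD).
  apply: eq_card => e; rewrite !inE.
  by have [eD|//] := boolP (e \in D); rewrite diaE.
have -> : adjacency_mx D (@diagram gT) = adjacency_mx D (adjacent f c).
  by apply/matrixP => i j; rewrite !mxE diaE ?enum_valP.
(* This puts the eigenvalue in the form [- (4 * q)] with [q = 4 ^ h]. *)
rewrite addn1 expnS.
by apply: (reflection_graph_spectrum f_nd f_witt c_unit c_fibre); rewrite expn_gt0.
Qed.
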